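(* Let $F$ be a probability distribution on $[a,b]$, $a<b$, $a,b\in\mathbb{R}$, with mean $\mu$, and let $n\in\mathbb{N}$. Then for any convex function $g:\mathbb{R}\to\mathbb{R}$, $$g(n\mu)\le \inf_{S\in\mathfrak S_n}\mathbb{E}[g(S)]\le \tfrac12\, g(n\mu+(b-a))+\tfrac12\, g(n\mu-(b-a)).$$
   Context: All random variables are defined on a common atomless probability space $(\Omega,\mathcal A,\mathbb P)$, on which independent random vectors with any distributions can be generated. For a distribution $F$, $\mathfrak S_n=\{X_1+\cdots+X_n: X_i\sim F,\ i=1,\ldots,n\}$ is the set of all sums of $n$ random variables each having distribution $F$, with arbitrary dependence. *)

(* Defs.v *)
From HB Require Import structures.
From mathcomp Require Import all_boot all_order all_algebra.
From mathcomp Require Import all_classical all_reals all_analysis.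

Set Implicit Arguments.
Unset Strict Implicit.
Unset Printing Implicit Defensive.

Import Order.TTheory GRing.Theory Num.Theory.
Import numFieldNormedType.Exports.

Local Open Scope classical_set_scope.
Local Open Scope ring_scope.

Section Defs.
Context {d : measure_display} {Omega : measurableType d} {R : realType}.
Variable P : probability Omega R.
Local Open Scope ereal_scope.

Definition atomless :=
  forall A : set Omega, measurable A -> 0 < P A ->
    exists2 B : set Omega, measurable B /\ B `<=` A & 0 < P B < P A.

Definition mutually_independent (I : finType) (m : I -> nat)
    (X : forall i : I, {RV P >-> (m i).-tuple R}) :=
  forall (J : {set I}) (B : forall i : I, set ((m i).-tuple R)),
    (forall i, i \in J -> measurable (B i)) ->
    P (\bigcap_(i in [set` J]) (X i @^-1` B i)) =
    \prod_(i in J) P (X i @^-1` B i).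

Definition has_law (d' : measure_display) (T : measurableType d')
    (X : {RV P >-> T}) (Q : probability T R) :=
  forall B : set T, measurable B -> distribution P X B = Q B.

(* Every atomless space has this property (it carries a uniform variable, hence
   a sequence of independent ones). Vectors are tuples with the product
   sigma-algebra; finite families of them are enough. *)
Definition generates_independent_vectors :=
  forall (k : nat) (m : 'I_k -> nat)
    (Q : forall i : 'I_k, probability ((m i).-tuple R) R),
    exists X : forall i : 'I_k, {RV P >-> (m i).-tuple R},
      (forall i, has_law (X i) (Q i)) /\ mutually_independent X.

Definition admissible_sums (n : nat) (F : probability R R) : set {RV P >-> R} :=
  [set S : {RV P >-> R} | exists2 X : 'I_n -> {RV P >-> R},
      (forall i, has_law (X i) F) &
      forall w, S w = (\sum_(i < n) X i w)%R].

End Defs.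

Arguments admissible_sums {d Omega R} P n F _.

(* Main.v *)
(** The lower bound is Jensen's inequality. For the upper bound it suffices to
    find an admissible [S] with [|S - n mu| <= b - a] almost surely, since the
    chord of [g] over [[n mu - (b - a), n mu + (b - a)]] then dominates [g(S)].
    As in Skorokhod's embedding, [F] is a mixture of two-point laws of mean
    [mu] on pairs [x <= mu < y], the pair having density proportional to
    [y - x] with respect to [F x F]. Such a pair together with a uniform point
    [t] of [[x, y)] is distributed as [F x F x Lebesgue] restricted to
    [x <= t < y], so no density is needed. Moving [t] by [mu - x] around the
    circle [[x, y)] preserves this measure, and the new position is
    [t + mu - X] with [X = y] if [t] went past the end and [X = x] otherwise.
    Each [X] has law [F], and along an orbit the sum telescopes to
    [n mu + t_0 - t_n], which is within [y - x <= b - a] of [n mu]. *)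
Require Import Defs.
From HB Require Import structures.
From mathcomp Require Import all_boot all_order all_algebra.
From mathcomp Require Import all_classical all_reals all_analysis measurable_realfun.
From mathcomp Require Import ring lra.
Import Order.TTheory GRing.Theory Num.Theory.
Import numFieldNormedType.Exports.
Local Open Scope classical_set_scope.
Local Open Scope ring_scope.

(** * Convex functions on the line: chords, tangents, measurability *)

Section ConvexReal.
Context {R : realType}.
Variable g : R -> R.
Hypothesis g_convex : convex_function (E := R^o) setT g.

Lemma convex_chord (lo hi x : R) : lo < hi -> lo <= x <= hi ->
  g x <= g lo + (g hi - g lo) / (hi - lo) * (x - lo).
Proof.
move=> lohi /andP[lox xhi].
have d0 : 0 < hi - lo by rewrite subr_gt0.
have t0 : 0 <= (hi - x) / (hi - lo) by rewrite divr_ge0 ?subr_ge0// ltW.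
have t1 : (hi - x) / (hi - lo) <= 1 by rewrite ler_pdivrMr// mul1r lerD2l lerN2.
pose t : {i01 R} := Itv01 t0 t1.
have inT z : z \in [set: R] by rewrite inE.
have h : g ((hi - x) / (hi - lo) * lo + (1 - (hi - x) / (hi - lo)) * hi) <=
    (hi - x) / (hi - lo) * g lo + (1 - (hi - x) / (hi - lo)) * g hi.
  exact: (@g_convex t lo hi (inT lo) (inT hi)).
have dn0 : hi - lo != 0 by rewrite gt_eqF.
have xE : (hi - x) / (hi - lo) * lo + (1 - (hi - x) / (hi - lo)) * hi = x.
  by field.
rewrite xE in h; apply: (le_trans h); rewrite le_eqVlt; apply/orP; left; apply/eqP; field.
exact: dn0.
Qed.

(** The slope [s] is the supremum of the slopes of chords that end at [m] from the left. By the
    chord inequality each of these is at most any slope from [m] to the right, which both makes the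
    supremum finite and gives the inequality on the right. *)
Lemma convex_tangent (m : R) :
  exists s : R, forall x, g m + s * (x - m) <= g x.
Proof.
pose slope x := (g m - g x) / (m - x).
pose A := [set slope x | x in [set x | x < m]].
have slope_le x y : x < m -> m < y -> slope x <= (g y - g m) / (y - m).
  move=> xm my; rewrite /slope.
  have xy : x < y by exact: lt_trans my.
  have xmy : x <= m <= y by rewrite !ltW.
  have h := @convex_chord x y m xy xmy.
  rewrite ler_pdivrMr ?subr_gt0// mulrAC ler_pdivlMr ?subr_gt0//.
  (* With denominators cleared, the chord inequality at [m] and the comparison of slopes are the
     same polynomial inequality up to rearrangement. *)
  have {h} : g m * (y - x) <= g x * (y - x) + (g y - g x) * (m - x).
    rewrite -(ler_pM2r (x := y - x)) ?subr_gt0// in h.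
    apply: (le_trans h); rewrite mulrDl lerD2l mulrAC.
    by rewrite divfK// gt_eqF// subr_gt0.
  nra.
have A0 : A !=set0 by exists (slope (m - 1)); exists (m - 1) => //=; lra.
have Aub y : m < y -> ubound A ((g y - g m) / (y - m)).
  by move=> my _ [x /= xm <-]; exact: slope_le.
have supA : has_sup A.
  by split => //; exists ((g (m + 1) - g m) / (m + 1 - m)); apply: Aub; lra.
exists (sup A) => x; have [xm|mx|->] := ltgtP x m; last by rewrite subrr mulr0 addr0.
- have : slope x <= sup A by apply: sup_upper_bound => //; exists x.
  by rewrite ler_pdivrMr ?subr_gt0//; lra.
- have : sup A <= (g x - g m) / (x - m) by apply: sup_le_ub => //; exact: Aub.
  by rewrite ler_pdivlMr ?subr_gt0//; lra.
Qed.

(** Strict sublevel sets of a convex function are intervals, and preimages of open left rays suffice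
    for measurability. *)
Lemma convex_measurable : measurable_fun setT g.
Proof.
apply: (measurability _ (RGenInftyO.measurableE R)) => //.
move=> _ [_ [r ->] <-]; rewrite setTI; apply: is_interval_measurable.
apply/is_intervalPlt => x y; rewrite /preimage /= !in_itv /= => gx gy z /andP[xz zy].
have xzy : x <= z <= y by rewrite !ltW.
apply: (le_lt_trans (@convex_chord x y z (lt_trans xz zy) xzy)).
have d0 : 0 < y - x by rewrite subr_gt0 (lt_trans xz).
rewrite -(ltr_pM2r d0) mulrDl mulrAC divfK ?gt_eqF//.
nra.
Qed.

End ConvexReal.

(** * Almost sure events and expectations of convex functions *)

Lemma probability1P {d : measure_display} {T : measurableType d} {R : realType}
    (P : probability T R) (A : set T) : measurable A ->
  P A = 1%E <-> {ae P, forall w, A w}.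
Proof.
move=> mA; split=> [PA|/negligibleP PA].
  exists (~` A); split => //; first exact: measurableC.
  by rewrite [LHS](@probability_setC _ _ _ P) // PA subee.
rewrite -(setCK A) [LHS](@probability_setC _ _ _ P); last exact: measurableC.
by rewrite (_ : P (~` A) = 0%E) ?sube0//; apply: PA; exact: measurableC.
Qed.

Section AlmostSure.
Context {d : measure_display} {T : measurableType d} {R : realType}.
Variable P : probability T R.

Section SureOn.
Variable A : set T.
Hypotheses (mA : measurable A) (PA : P A = 1%E).

Lemma integrable_bounded_on (f : T -> R) (M : R) :
  measurable_fun setT f -> (forall w, A w -> `|f w| <= M) ->
  P.-integrable setT (EFin \o f).
Proof.
move=> mf fM.
have N0 : P (~` A) = 0%E by rewrite probability_setC// PA subee.
have mf' : measurable_fun setT (EFin \o f) by exact/measurable_EFinP.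
apply/(negligible_integrable (measurableC mA) measurableT mf' N0).
rewrite setTD setCK; apply: measurable_bounded_integrable => //.
- by rewrite ltey_eq fin_num_measure.
- exact: measurable_funTS.
- exists M; split; first exact: num_real.
  by move=> y My w Aw /=; apply: (le_trans (fM _ Aw)); exact: ltW.
Qed.

Lemma le_integral_on (f h : T -> \bar R) :
  P.-integrable setT f -> P.-integrable setT h ->
  (forall w, A w -> f w <= h w)%E -> (\int[P]_w f w <= \int[P]_w h w)%E.
Proof.
move=> intf inth fh.
have N0 : P (~` A) = 0%E by rewrite probability_setC// PA subee.
rewrite (negligible_integral (measurableC mA) measurableT intf N0).
rewrite (negligible_integral (measurableC mA) measurableT inth N0).
rewrite setTD setCK; apply: le_integral => //.
- exact: (integrableS measurableT).
- exact: (integrableS measurableT).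
- by move=> w; rewrite inE; exact: fh.
Qed.

Lemma integral_affine (S : T -> R) (m c k e : R) :
  P.-integrable setT (EFin \o S) -> (\int[P]_w (S w)%:E = m%:E)%E ->
  P.-integrable setT (fun w => (c + k * (S w - e))%:E) /\
  (\int[P]_w (c + k * (S w - e))%:E = (c + k * (m - e))%:E)%E.
Proof.
move=> iS ES.
have -> : (fun w => (c + k * (S w - e))%:E) =
    ((fun=> (c - k * e)%:E) \+ (fun w => k%:E * (EFin \o S) w))%E.
  by apply/funext => w /=; rewrite -EFinM -EFinD; congr EFin; ring.
have i1 : P.-integrable setT (fun=> (c - k * e)%:E).
  exact: finite_measure_integrable_cst.
have i2 : P.-integrable setT (fun w => k%:E * (EFin \o S) w)%E.
  exact: integrableZl.
split; first exact: integrableD.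
rewrite integralD// integral_cst// integralZl// [X in (_ * X + _)%E](@probability_setT _ _ _ P) mule1 /=.
rewrite ES -EFinM -EFinD; congr EFin; ring.
Qed.

(** The tangent at the mean bounds [g] from below everywhere, and the chord over [[lo, hi]] bounds
    it from above there. Both are affine, so their expectations at [S] depend on [m] alone. *)
Lemma convex_expectation_bounds (g : R -> R) (S : T -> R) (m lo hi : R) :
  convex_function (E := R^o) setT g -> measurable_fun setT S ->
  ('E_P[S] = m%:E)%E -> lo < hi -> (forall w, A w -> lo <= S w <= hi) ->
  ((g m)%:E <= 'E_P[g \o S] <=
    (g lo + (g hi - g lo) / (hi - lo) * (m - lo))%:E)%E.
Proof.
move=> cg mS; rewrite unlock => ES lohi Sb.
have iS : P.-integrable setT (EFin \o S).
  apply: (@integrable_bounded_on S (`|lo| + `|hi|)) => // w /Sb /andP[? ?].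
  have := ler_norm lo; have := ler_norm hi.
  have := ler_norm (- lo); have := ler_norm (- hi).
  by rewrite !normrN ler_norml; move=> *; apply/andP; split; lra.
have [s tang] := @convex_tangent _ g cg m.
set k := (g hi - g lo) / (hi - lo).
have chord x : lo <= x <= hi -> g x <= g lo + k * (x - lo).
  exact: convex_chord.
have igS : P.-integrable setT (EFin \o (g \o S)).
  (* The first two terms bound the chord from above on [[lo, hi]], and the last two bound the
     tangent from below; [g] lies between these two lines. *)
  pose M := `|g lo| + `|k| * (hi - lo) +
    (`|g m| + `|s| * (`|lo| + `|hi| + `|m|)).
  apply: (@integrable_bounded_on (g \o S) M).
    by apply: measurableT_comp => //; exact: convex_measurable.
  move=> w Aw /=; have /andP[h1 h2] := Sb _ Aw.
  have up := chord _ (Sb _ Aw); have lw := tang (S w).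
  have u1 : k * (S w - lo) <= `|k| * (hi - lo).
    apply: (le_trans (ler_norm _)); rewrite normrM ler_wpM2l//.
    by rewrite ger0_norm ?subr_ge0// lerD2r.
  have l1 : - (`|s| * (`|lo| + `|hi| + `|m|)) <= s * (S w - m).
    rewrite lerNl; apply: (le_trans (ler_norm _)); rewrite normrN normrM ler_wpM2l//.
    have := ler_norm lo; have := ler_norm hi; have := ler_norm m.
    have := ler_norm (- lo); have := ler_norm (- hi); have := ler_norm (- m).
    by rewrite !normrN ler_norml; move=> *; apply/andP; split; lra.
  have p1 : 0 <= `|k| * (hi - lo) by rewrite mulr_ge0// subr_ge0 ltW.
  have p2 : 0 <= `|s| * (`|lo| + `|hi| + `|m|) by rewrite mulr_ge0// !addr_ge0.
  have := ler_norm (g lo); have := ler_norm (- g m).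
  have := normr_ge0 (g lo); have := normr_ge0 (g m).
  by rewrite normrN ler_norml /M; move=> *; apply/andP; split; lra.
have [il El] := @integral_affine S m (g m) s m iS ES.
have [iu Eu] := @integral_affine S m (g lo) k lo iS ES.
apply/andP; split.
- have <- : (g m + s * (m - m))%:E = (g m)%:E by rewrite subrr mulr0 addr0.
  rewrite -El; apply: le_integral_on => // w _; rewrite lee_fin; exact: tang.
- rewrite -Eu; apply: le_integral_on => // w Aw; rewrite lee_fin.
  exact/chord/Sb.
Qed.

End SureOn.
End AlmostSure.

(** The image of Lebesgue measure under a translation agrees with it on half-open intervals, and
    this determines the measure. *)
Lemma lebesgue_measure_shift {R : realType} (c : R) (A : set R) :
  measurable A ->
  lebesgue_measure ((fun t => t + c) @^-1` A) = lebesgue_measure A.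
Proof.
have mshift : measurable_fun setT (fun t : R => t + c : measurableTypeR R).
  exact: measurable_funD.
pose f : {mfun R >-> measurableTypeR R} :=
  HB.pack (fun t : R => t + c : measurableTypeR R)
    (isMeasurableFun.Build _ _ _ _ _ mshift).
move=> mA; rewrite -[LHS]/(pushforward lebesgue_measure f A).
apply/esym/lebesgue_measure_unique => //= _ [[u v]] _ <-.
rewrite /pushforward.
have -> : f @^-1` `]u, v]%classic = `]u - c, v - c]%classic.
  by apply/seteqP; split => t /=; rewrite !in_itv /= ltrBlDr lerBrDr.
rewrite !lebesgue_measure_itv /= !lte_fin ltrD2r.
by case: ifP => // _; rewrite -!EFinB; congr EFin; ring.
Qed.

(** * The rotation of the circle [[x, y)] and the values drawn along its orbits *)

Section Rotation.
Context {R : realType}.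
Variables (a b mu : R).
Implicit Types (z : R * R * measurableTypeR R).

(** The point [mu] is put in the left interval only, so [x < y] always holds and no circle is empty.
    The range of the last coordinate is half-open so that the rotation keeps it inside. *)
Definition states : set (R * R * measurableTypeR R) :=
  [set z | (`[a, mu] `*` `]mu, b]) z.1 /\ z.1.1 <= z.2 < z.1.2].

(* [draw] and [rotate] are meant on [states], where [rotate] is the rotation of
   the circle [[x, y)] by [mu - x]. The last coordinate lives in
   [measurableTypeR R], the carrier of [lebesgue_measure], whose display is not
   the default one of [R]. *)
Definition draw z : R := if z.1.2 <= z.2 + mu - z.1.1 then z.1.2 else z.1.1.

Definition rotate z : R * R * measurableTypeR R := (z.1, z.2 + mu - draw z).

Lemma rotate_states z : states z -> states (rotate z).
Proof.
case: z => [[x y] t]; rewrite /states /rotate /draw /= !in_itv /=.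
move=> [[/andP[ax xmu] /andP[muy yb]] /andP[xt ty]].
split; first by rewrite ax xmu muy yb.
by case: ifPn; rewrite -?ltNge => ?; apply/andP; split; lra.
Qed.

Lemma iter_rotate_states n z : states z -> states (iter n rotate z).
Proof. by move=> zS; elim: n => //= n; exact: rotate_states. Qed.

Lemma sum_draw n z :
  \sum_(i < n) draw (iter i rotate z) = n%:R * mu + z.2 - (iter n rotate z).2.
Proof.
elim: n => [|n IHn]; first by rewrite big_ord0 /= mul0r; ring.
by rewrite big_ord_recr IHn /= mulrSr; ring.
Qed.

(** After telescoping, what remains is the difference between the first and last positions. The
    rotation fixes the pair, so both positions lie in the same [[x, y)], which is contained in
    [[a, b]]. *)
Lemma sum_draw_dist n z : states z ->
  `|\sum_(i < n) draw (iter i rotate z) - n%:R * mu| <= b - a.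
Proof.
move=> zS; rewrite sum_draw; have := iter_rotate_states n z zS; move: zS.
have : (iter n rotate z).1 = z.1 by elim: n.
case: z (iter n rotate z) => [[x y] t] [[x' y'] t'].
rewrite /states /= !in_itv /= => -[-> ->].
move=> [[/andP[ax xmu] /andP[muy yb]] /andP[xt ty]] [_ /andP[xt' ty']].
by rewrite ler_norml; apply/andP; split; lra.
Qed.

Lemma measurable_coords :
  [/\ measurable_fun setT (fun z : R * R * measurableTypeR R => z.1.1),
      measurable_fun setT (fun z : R * R * measurableTypeR R => z.1.2) &
      measurable_fun setT (fun z : R * R * measurableTypeR R => z.2)].
Proof.
split; last exact: measurable_snd.
- exact: (measurableT_comp measurable_fst measurable_fst).
- exact: (measurableT_comp measurable_snd measurable_fst).
Qed.

Lemma measurable_draw : measurable_fun setT draw.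
Proof.
have [m1 m2 m3] := measurable_coords.
apply: measurable_fun_ifT => //; apply: measurable_fun_ler => //.
by apply: measurable_funB => //; exact: measurable_funD.
Qed.

Lemma measurable_rotate : measurable_fun setT rotate.
Proof.
have [m1 m2 m3] := measurable_coords.
apply: measurable_fun_pair; first exact: measurable_fst.
apply: measurable_funB; last exact: measurable_draw.
exact: measurable_funD.
Qed.

Lemma measurable_states : measurable states.
Proof.
have [m1 m2 m3] := measurable_coords.
have -> : states = (fst @^-1` (`[a, mu] `*` `]mu, b])) `&`
    ([set z | z.1.1 <= z.2] `&` [set z | z.2 < z.1.2]).
  by apply/seteqP; split => z; rewrite /states /=; [move=> [? /andP[]]|move=> [? [-> ->]]].
apply: measurableI.
  rewrite -[X in measurable X]setTI; apply: measurable_fst => //.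
  by apply: measurableX; exact: measurable_itv.
apply: measurableI.
- have := measurable_fun_ler m1 m3 => /(_ measurableT [set true]).
  by rewrite setTI; apply.
- have := measurable_fun_ltr m3 m2 => /(_ measurableT [set true]).
  by rewrite setTI; apply.
Qed.

(** Lebesgue measure as a bare set function on [R], so that slices can be written as sets of reals
    rather than over [measurableTypeR R]. *)
Let leb : set R -> \bar R := @lebesgue_measure R.

(* On [[x, x + y - mu)] and [[x + y - mu, y)] the rotation is a translation, and
   it exchanges them with [[mu, y)] and [[x, mu)]. *)
Lemma lebesgue_rotate_slice (x y : R) (A : set R) :
  x <= mu -> mu < y -> measurable A ->
  leb [set t : R | x <= t < y /\ A (rotate (x, y, t)).2] =
  leb [set t : R | x <= t < y /\ A t].
Proof.
move=> xmu muy mA.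
have -> : [set t : R | x <= t < y /\ A (rotate (x, y, t)).2] =
    ((fun t : R => t + (mu - x)) @^-1` (`[mu, y[%classic `&` A : set R)) `|`
    ((fun t : R => t + (mu - y)) @^-1` (`[x, mu[%classic `&` A : set R)).
  apply/seteqP; split => t; rewrite /= /draw /= !in_itv /=;
    have shiftE c : t + (mu - c) = t + mu - c by rewrite addrA.
    rewrite !shiftE => -[/andP[xt ty]].
    case: ifPn; rewrite -?ltNge => h At; [right|left].
      by split => //; apply/andP; split; lra.
    by split => //; apply/andP; split; lra.
  rewrite !shiftE => -[|] [/andP[h1 h2]] At.
    split; first by apply/andP; split; lra.
    by case: ifPn => //; rewrite -?ltNge => ?; lra.
  split; first by apply/andP; split; lra.
  by case: ifPn => //; rewrite -?ltNge => ?; lra.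
have -> : [set t : R | x <= t < y /\ A t] =
    (`[mu, y[%classic `&` A : set R) `|` (`[x, mu[%classic `&` A : set R).
  apply/seteqP; split => t /=; rewrite !in_itv /=.
    move=> [/andP[xt ty] At]; have [tmu|tmu] := ltP t mu.
      by right; split => //; apply/andP.
    by left; split => //; apply/andP.
  by move=> [|] [/andP[h1 h2] At]; split => //; apply/andP; split; lra.
have m1 : measurable (`[mu, y[%classic `&` A : set R).
  by apply: measurableI => //; exact: measurable_itv.
have m2 : measurable (`[x, mu[%classic `&` A : set R).
  by apply: measurableI => //; exact: measurable_itv.
have mshift c B : measurable B -> measurable ((fun t : R => t + c) @^-1` B).
  move=> mB; rewrite -[X in measurable X]setTI.
  exact: (measurable_funD (@measurable_id _ _ _) (@measurable_cst _ _ _ _ _ c)).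
rewrite /leb !measureU //; do ?[exact: mshift].
- by congr (_ + _)%E; exact: lebesgue_measure_shift.
- by apply/seteqP; split => // t /=; rewrite !in_itv /= =>
    -[[/andP[? ?] _] [/andP[? ?] _]]; lra.
- by apply/seteqP; split => // t /=; rewrite !in_itv /= =>
    -[[/andP[? ?] _] [/andP[? ?] _]]; lra.
Qed.

(** The draw is [x] for [t] in [[x, x + y - mu)], of length [y - mu], and [y] on the rest, of length
    [mu - x]. These lengths are the weights of the two-point law on [x] and [y] with mean [mu],
    multiplied by [y - x]. *)
Lemma lebesgue_draw_slice (x y : R) (B : set R) : x <= mu -> mu < y ->
  leb [set t : R | x <= t < y /\ B (draw (x, y, t))] =
  (\1_B x * (y - mu) + \1_B y * (mu - x))%:E.
Proof.
move=> xmu muy; rewrite !indicE; have xy : x < y by apply: le_lt_trans muy.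
have itvE u v : u <= v -> leb `[u, v[%classic = (v - u)%:E.
  rewrite /leb lebesgue_measure_itv /= lte_fin le_eqVlt => /predU1P[->|->//].
  by rewrite ltxx subrr.
(* The cases come in the order: both points in [B], only [x], only [y], neither. *)
have [xB|xB] := boolP (x \in B); have [yB|yB] := boolP (y \in B).
- rewrite !mul1r (_ : [set _ | _] = `[x, y[%classic).
    by rewrite itvE ?ltW//; congr EFin; ring.
  apply/seteqP; split => t /=; rewrite in_itv /=; first by case.
  move=> ->; split => //.
  by rewrite /draw; case: ifP => _; exact: set_mem.
- rewrite mul1r mul0r addr0 (_ : [set _ | _] = `[x, x + y - mu[%classic).
    by rewrite itvE; [congr EFin; ring|lra].
  apply/seteqP; split => t /=; rewrite in_itv /= /draw /=.
    move=> [/andP[xt ty]]; case: ifPn; rewrite -?ltNge => h.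
      by move=> /mem_set; rewrite (negbTE yB).
    by move=> _; apply/andP; split; lra.
  move=> /andP[xt h]; split; first by apply/andP; split; lra.
  rewrite ifF; first exact: set_mem.
  by apply/negbTE; rewrite -ltNge; lra.
- rewrite mul1r mul0r add0r (_ : [set _ | _] = `[x + y - mu, y[%classic).
    by rewrite itvE; [congr EFin; ring|lra].
  apply/seteqP; split => t /=; rewrite in_itv /= /draw /=.
    move=> [/andP[xt ty]]; case: ifPn; rewrite -?ltNge => h.
      by move=> _; apply/andP; split; lra.
    by move=> /mem_set; rewrite (negbTE xB).
  move=> /andP[xt h]; split; first by apply/andP; split; lra.
  by rewrite ifT; [exact: set_mem|lra].
- rewrite !mul0r addr0 (_ : [set _ | _] = set0); first exact: measure0.
  apply/seteqP; split => // t /= [_]; rewrite /draw.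
  by case: ifP => _ /= /mem_set; rewrite ?(negbTE xB) ?(negbTE yB).
Qed.

End Rotation.

(** * The measure on states and its behaviour under [rotate] and [draw] *)

Section Coupling.
Context {R : realType}.
Variables (a b mu : R) (F : probability R R).

(* Not normalised: its mass is [E (X - mu)^+] for [X] of law [F]. *)
Definition state_measure : {measure set (R * R * measurableTypeR R) -> \bar R} :=
  mrestr (((F \x F) \x (@lebesgue_measure R))%E)
    (@measurable_states R a b mu).

Lemma state_measureE A : state_measure A =
  (\int[F \x F]_p lebesgue_measure (xsection (A `&` states a b mu) p))%E.
Proof. by []. Qed.

Lemma xsection_states (C : set (R * R * measurableTypeR R)) (p : R * R) :
  xsection (C `&` states a b mu) p =
  if p \in `[a, mu] `*` `]mu, b] then
    [set t : R | p.1 <= t < p.2 /\ C (p, t)] else set0.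
Proof.
rewrite xsectionE; case: ifPn => [/set_mem pP|/negP pP].
  by apply/seteqP; split => t; rewrite /states /=; [move=> [? []]|move=> []].
by apply/seteqP; split => // t [_ [/mem_set]].
Qed.

Lemma pairsP (p : R * R) : p \in `[a, mu] `*` `]mu, b] ->
  p.1 <= mu /\ mu < p.2.
Proof.
by move=> /set_mem [] /=; rewrite !in_itv /= => /andP[_ ->] /andP[-> _].
Qed.

(** The rotation leaves the pair [(x, y)] fixed, so invariance reduces to that of Lebesgue measure
    on each slice. *)
Lemma state_measure_rotate (A : set (R * R * measurableTypeR R)) : measurable A ->
  state_measure (rotate mu @^-1` A) = state_measure A.
Proof.
move=> mA; rewrite !state_measureE; apply: eq_integral => p _; rewrite !xsection_states.
case: ifPn => // /pairsP; case: p => x y /= [xmu muy].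
have := @lebesgue_rotate_slice R mu x y (xsection A (x, y)) xmu muy.
rewrite xsectionE; apply; rewrite -xsectionE; exact: measurable_xsection.
Qed.

(** The length of each slice is written as two terms, each a function of [x] times a function of
    [y], so that Tonelli factors the integrals later. *)
Lemma state_measure_draw (B : set R) : measurable B ->
  state_measure (draw mu @^-1` B) =
  (\int[F \x F]_p
    ((\1_(`[a, mu] `&` B) p.1 * (\1_`]mu, b] p.2 * (p.2 - mu)))%:E +
     (\1_`[a, mu] p.1 * (mu - p.1) * \1_(`]mu, b] `&` B) p.2)%:E))%E.
Proof.
move=> mB; rewrite state_measureE; apply: eq_integral => p _; rewrite xsection_states.
(* Off the rectangle of admissible pairs the slice is empty, and in each term on the right one of
   the two indicators vanishes. *)
case: ifPn => pP; last first.
  rewrite measure0 !indicE !in_setI; move: pP; rewrite in_setX.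
  case: (p.1 \in `[a, mu]%classic); case: (p.2 \in `]mu, b]%classic) => //= _;
    by rewrite ?(mul0r, mulr0) adde0.
have [xmu muy] := pairsP _ pP; case: p pP xmu muy => x y /= pP xmu muy.
rewrite (lebesgue_draw_slice mu x y B xmu muy).
move: pP; rewrite in_setX /= => /andP[xI yI].
by rewrite !indicE !in_setI xI yI /= -EFinD !mul1r [X in _ + X]mulrC.
Qed.

End Coupling.

Lemma integral_prod_mul {R : realType} (F G : probability R R) (u v : R -> R) :
  measurable_fun setT u -> measurable_fun setT v ->
  (forall x, 0 <= u x) -> (forall x, 0 <= v x) ->
  (\int[F \x G]_p (u p.1 * v p.2)%:E =
    (\int[F]_x (u x)%:E) * (\int[G]_x (v x)%:E))%E.
Proof.
move=> mu mv u0 v0.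
have mu' : measurable_fun setT (EFin \o u) by exact/measurable_EFinP.
have mv' : measurable_fun setT (EFin \o v) by exact/measurable_EFinP.
rewrite fubini_tonelli1 /=.
- under eq_integral => x _.
    rewrite /fubini_F /=; under eq_integral do rewrite EFinM.
    rewrite ge0_integralZl //; [|by move=> y _; rewrite lee_fin|by rewrite lee_fin].
    over.
  rewrite ge0_integralZr //; first by move=> x _; rewrite lee_fin.
  by apply: integral_ge0 => y _; rewrite lee_fin.
- apply/measurable_EFinP; apply: measurable_funM.
  + exact: (measurableT_comp mu measurable_fst).
  + exact: (measurableT_comp mv measurable_snd).
- by move=> p; rewrite lee_fin mulr_ge0.
Qed.

(** * The law of a single draw *)

Section Law.
Context {R : realType}.
Variables (a b mu : R) (F : probability R R).
Hypothesis F_supp : F `[a, b]%classic = 1%E.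
Hypothesis F_mean : ('E_F[idfun] = mu%:E)%E.

(** On [[a, b]], [upper] and [lower] are the positive and negative parts of the deviation from
    [mu]. *)
Let upper (y : R) := \1_`]mu, b] y * (y - mu).
Let lower (x : R) := \1_`[a, mu] x * (mu - x).

Let upper_ge0 y : 0 <= upper y.
Proof.
rewrite /upper indicE; case: (boolP (y \in _)) => [/set_mem /=|]; rewrite ?mul0r//.
by rewrite in_itv /= mul1r subr_ge0 => /andP[/ltW].
Qed.

Let lower_ge0 x : 0 <= lower x.
Proof.
rewrite /lower indicE; case: (boolP (x \in _)) => [/set_mem /=|]; rewrite ?mul0r//.
by rewrite in_itv /= mul1r subr_ge0 => /andP[].
Qed.

Let measurable_upper : measurable_fun setT upper.
Proof. by apply: measurable_funM => //; exact: measurable_funB. Qed.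

Let measurable_lower : measurable_fun setT lower.
Proof. by apply: measurable_funM => //; exact: measurable_funB. Qed.

Let mI : measurable (`[a, b]%classic : set R).
Proof. exact: measurable_itv. Qed.

Lemma integrable_support (f : R -> R) (M : R) : measurable_fun setT f ->
  (forall x, a <= x <= b -> `|f x| <= M) -> F.-integrable setT (EFin \o f).
Proof.
move=> mf fM; apply: (integrable_bounded_on F `[a, b]%classic mI F_supp f M mf).
by move=> x /=; rewrite in_itv; exact: fM.
Qed.

Let integrable_id : F.-integrable setT (EFin \o (@idfun R)).
Proof.
apply: (@integrable_support _ (`|a| + `|b|)); first exact: measurable_id.
move=> x /andP[ax xb].
have := ler_norm a; have := ler_norm b.
have := ler_norm (- a); have := ler_norm (- b).
by rewrite !normrN ler_norml /=; move=> *; apply/andP; split; lra.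
Qed.

Lemma mean_bounds : a <= mu <= b.
Proof.
have E : (\int[F]_x (x%:E) = mu%:E)%E by rewrite -F_mean unlock.
have ic c : F.-integrable setT (fun=> c%:E).
  exact: finite_measure_integrable_cst.
have Ec c : (\int[F]_x c%:E = c%:E)%E.
  by rewrite integral_cst // [X in (_ * X)%E](@probability_setT _ _ _ F) mule1.
rewrite -!lee_fin -E -(Ec a) -(Ec b).
apply/andP; split; apply: (le_integral_on F `[a, b]%classic mI F_supp) => //;
  by move=> x /=; rewrite in_itv /= => /andP[? ?]; rewrite lee_fin.
Qed.

(** On [[a, b]] the difference [upper - lower] is the deviation from [mu], which integrates to zero.
    The common value [c] is the total mass of the state measure, used below to normalise it. *)
Lemma mean_deviations_balance : exists c : R, [/\ 0 <= c,
  (\int[F]_y (upper y)%:E = c%:E)%E & (\int[F]_x (lower x)%:E = c%:E)%E].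
Proof.
have /andP[amu mub] := mean_bounds.
have iu : F.-integrable setT (EFin \o upper).
  apply: (@integrable_support _ (b - a)) => // x /andP[ax xb].
  rewrite ger0_norm// /upper indicE.
  by case: (_ \in _); rewrite ?mul0r ?mul1r; lra.
have il : F.-integrable setT (EFin \o lower).
  apply: (@integrable_support _ (b - a)) => // x /andP[ax xb].
  rewrite ger0_norm// /lower indicE.
  by case: (_ \in _); rewrite ?mul0r ?mul1r; lra.
have E : (\int[F]_x (x%:E) = mu%:E)%E by rewrite -F_mean unlock.
have [ia Ea] := integral_affine F (@idfun R) mu 0 1 mu integrable_id E.
have : (\int[F]_x (upper x)%:E - \int[F]_x (lower x)%:E = 0)%E.
  rewrite -integralB_EFin//.
  have <- : (\int[F]_x (0 + 1 * (x - mu))%:E = 0)%E.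
    by rewrite Ea subrr mulr0 addr0.
  have ul x : `[a, b]%classic x ->
      ((upper x)%:E - (lower x)%:E = (0 + 1 * (x - mu))%:E)%E.
    rewrite /= in_itv /= => /andP[ax xb]; rewrite -EFinB; congr EFin.
    rewrite /upper /lower !indicE !mem_setE !in_itv /= ax xb andbT /=.
    by case: ltP => _ /=; rewrite ?mul0r ?mul1r; ring.
  have iul := integrableB measurableT iu il.
  (* The two integrands agree only on the full-measure set [[a, b]], so the integrals are compared
     by an inequality in each direction. *)
  apply/eqP; rewrite eq_le; apply/andP; split;
    by apply: (le_integral_on F `[a, b]%classic mI F_supp) => // x /ul ->.
have fu : (\int[F]_y (upper y)%:E)%E \is a fin_num by exact: integrable_fin_num.
have fl : (\int[F]_y (lower y)%:E)%E \is a fin_num by exact: integrable_fin_num.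
move=> ul; exists (fine (\int[F]_y (upper y)%:E)%E); split.
- by apply: fine_ge0; apply: integral_ge0 => x _; rewrite lee_fin.
- by rewrite fineK.
- move: ul; rewrite -(fineK fu) -(fineK fl) -EFinB => -[] /eqP.
  by rewrite subr_eq0 => /eqP ->.
Qed.

(** By Tonelli the two terms are [F] of the part of [B] in [[a, mu]] times the integral of [upper],
    and [F] of the part in []mu, b]] times the integral of [lower]. Both integrals being [c], the
    two parts of [B] recombine. *)
Lemma state_measure_draw_law (c : R) (B : set R) : measurable B ->
  (\int[F]_y (upper y)%:E = c%:E)%E -> (\int[F]_x (lower x)%:E = c%:E)%E ->
  state_measure a b mu F (draw mu @^-1` B) = (c%:E * F B)%E.
Proof.
move=> mB Eu El.
have mL : measurable (`[a, mu]%classic `&` B : set R).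
  by apply: measurableI => //; exact: measurable_itv.
have mU : measurable (`]mu, b]%classic `&` B : set R).
  by apply: measurableI => //; exact: measurable_itv.
have mprod (u v : R -> R) : measurable_fun setT u -> measurable_fun setT v ->
    measurable_fun setT (fun p : R * R => (u p.1 * v p.2)%:E).
  move=> mu' mv'; apply/measurable_EFinP; apply: measurable_funM.
  - exact: (measurableT_comp mu' measurable_fst).
  - exact: (measurableT_comp mv' measurable_snd).
rewrite state_measure_draw// ge0_integralD//; first last.
- by apply: (mprod lower (\1_(`]mu, b] `&` B))) => //; exact: measurable_indic.
- by move=> p _; rewrite lee_fin; apply: mulr_ge0; [exact: lower_ge0|rewrite indicE].
- by apply: (mprod (\1_(`[a, mu] `&` B)) upper) => //; exact: measurable_indic.
- by move=> p _; rewrite lee_fin; apply: mulr_ge0; [rewrite indicE|exact: upper_ge0].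
rewrite (integral_prod_mul F F (\1_(`[a, mu] `&` B)) upper)//.
rewrite (integral_prod_mul F F lower (\1_(`]mu, b] `&` B)))//.
rewrite Eu El !integral_indic// !setIT muleC -ge0_muleDr//.
(* The indicators see only the part of [B] inside [[a, b]]; the rest is negligible for [F]. *)
have out0 : F (B `\` `[a, b]%classic) = 0%E.
  apply: (@subset_measure0 _ _ _ F _ (~` `[a, b]%classic)).
  - exact: measurableD.
  - exact: measurableC.
  - by move=> x [].
  - by rewrite [LHS](@probability_setC _ _ _ F) // F_supp subee.
have /andP[amu mub] := mean_bounds.
have -> : F B = F (B `&` `[a, b]%classic).
  transitivity (F (B `\` `[a, b]%classic) + F (B `&` `[a, b]%classic))%E.
    exact: measureDI.
  by rewrite out0 add0e.
rewrite -measureU//.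
- congr (_ * F _)%E; apply/seteqP; split => x /=; rewrite !in_itv /=.
    by move=> [|] [/andP[h1 h2] Bx]; split => //; apply/andP; split; lra.
  move=> [Bx /andP[ax xb]]; have [xmu|mux] := leP x mu.
    by left; split => //; apply/andP.
  by right; split => //; apply/andP.
- by apply/seteqP; split => // x /=; rewrite !in_itv /= =>
    -[[/andP[_ xmu] _] [/andP[/(le_lt_trans xmu)]]]; rewrite ltxx.
Qed.

End Law.

(** Only the joint law of the summands matters: a coupling built on an auxiliary space is carried
    over to [Omega] by generating a random vector with that joint law. The event [D] is where the
    sum is known to lie in [A]. *)
Lemma exists_admissible_sum {d : measure_display} {Omega : measurableType d}
    {R : realType} (P : probability Omega R) {d' : measure_display}
    {T : measurableType d'} (Q : probability T R) (F : probability R R)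
    (n : nat) (Y : 'I_n -> T -> R) (A : set R) (D : set T) :
  generates_independent_vectors P ->
  (forall i, measurable_fun setT (Y i)) ->
  (forall i B, measurable B -> Q (Y i @^-1` B) = F B) ->
  measurable A -> measurable D -> Q D = 1%E ->
  (forall z, D z -> A (\sum_(i < n) Y i z)) ->
  exists2 S : {RV P >-> R}, admissible_sums P n F S & P (S @^-1` A) = 1%E.
Proof.
move=> rich mY lawY mA mD QD DA.
have mV : measurable_fun setT (fun z => [tuple Y i z | i < n]).
  apply/measurable_fun_tnthP => i; apply: eq_measurable_fun (mY i) => z _ /=.
  by rewrite tnth_mktuple.
pose V : {mfun T >-> n.-tuple R} :=
  HB.pack (fun z => [tuple Y i z | i < n]) (isMeasurableFun.Build _ _ _ _ _ mV).
have VE z j : tnth (V z) j = Y j z by exact: tnth_mktuple.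
(* A family of one vector of length [n]: the dependence between the [Y i] is contained in its
   law. *)
have [W [lawW _]] := rich 1 (fun=> n) (fun=> distribution Q V).
have mX i : measurable_fun setT (fun w => tnth (W ord0 w) i).
  exact: (measurableT_comp (measurable_tnth i) (measurable_funPT (W ord0))).
pose X i : {RV P >-> R} :=
  HB.pack (fun w => tnth (W ord0 w) i) (isMeasurableFun.Build _ _ _ _ _ (mX i)).
have mS : measurable_fun setT (fun w => \sum_(i < n) X i w).
  by apply: measurable_sum => i; exact: mX.
pose S : {RV P >-> R} :=
  HB.pack (fun w => \sum_(i < n) X i w) (isMeasurableFun.Build _ _ _ _ _ mS).
exists S.
  exists X => // i B mB.
  have mB' : measurable ((fun v : n.-tuple R => tnth v i) @^-1` B).
    by rewrite -[X in measurable X]setTI; exact: measurable_tnth.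
  transitivity (Q (V @^-1` ((fun v : n.-tuple R => tnth v i) @^-1` B))).
    exact: lawW.
  rewrite -(lawY i B mB); congr (Q _); apply/funext => z.
  by rewrite -[LHS]/(B (tnth (V z) i)) VE.
have mA' : measurable ((fun v : n.-tuple R => \sum_(i < n) tnth v i) @^-1` A).
  rewrite -[X in measurable X]setTI; apply: measurable_sum => // i.
  exact: measurable_tnth.
transitivity (Q (V @^-1` ((fun v : n.-tuple R => \sum_(i < n) tnth v i) @^-1` A))).
  exact: lawW.
have mVA : measurable
    (V @^-1` ((fun v : n.-tuple R => \sum_(i < n) tnth v i) @^-1` A)).
  by rewrite -[X in measurable X]setTI; exact: (measurable_funPT V).
(* The event that the sum lies in [A] contains [D], so its probability is at least 1. *)
apply/eqP; rewrite eq_le probability_le1//= -QD; apply: le_measure; rewrite ?inE//.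
move=> z /DA; suff -> : \sum_(i < n) Y i z = \sum_(i < n) tnth (V z) i by [].
by apply: eq_bigr => i _; rewrite VE.
Qed.

(** * An admissible sum within [b - a] of [n mu] *)

Section Concentration.
Context {R : realType}.
Variables (a b mu : R) (F : probability R R).
Hypothesis F_supp : F `[a, b]%classic = 1%E.
Hypothesis F_mean : ('E_F[idfun] = mu%:E)%E.

(** The two conclusions go through one induction because invariance under a further rotation
    requires the previous preimage to be measurable. *)
Lemma iter_rotate_preimage n (A : set (R * R * measurableTypeR R)) :
  measurable A -> measurable (iter n (rotate mu) @^-1` A) /\
  state_measure a b mu F (iter n (rotate mu) @^-1` A) = state_measure a b mu F A.
Proof.
move=> mA; elim: n => [|n [mn IHn]] //.
have -> : iter n.+1 (rotate mu) @^-1` A =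
    rotate mu @^-1` (iter n (rotate mu) @^-1` A).
  by apply/seteqP; split => z; rewrite /preimage /= -iterSr.
split; last by rewrite state_measure_rotate.
rewrite -[X in measurable X]setTI; exact: measurable_rotate.
Qed.

(** A nonnegative function with zero integral vanishes almost everywhere, so almost every point of
    [[a, b]] is neither above nor below [mu]. *)
Lemma degenerate_of_no_deviation :
  (\int[F]_y (\1_`]mu, b] y * (y - mu))%:E = 0)%E ->
  (\int[F]_x (\1_`[a, mu] x * (mu - x))%:E = 0)%E -> F [set mu] = 1%E.
Proof.
have ae0 (f : R -> \bar R) : measurable_fun setT f -> (forall x, 0 <= f x)%E ->
    (\int[F]_x f x = 0)%E -> ae_eq F setT f (cst 0%E).
  move=> mf f0 If; apply/(ae_eq_integral_abs F measurableT mf).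
  by rewrite -[RHS]If; apply: eq_integral => x _; rewrite gee0_abs.
move=> /ae0 aeU /ae0 aeL.
have mI : measurable (`[a, b]%classic : set R) by exact: measurable_itv.
have aeI : {ae F, forall x, `[a, b]%classic x} by apply/probability1P.
have {}aeU : {ae F, forall x, [set: R] x -> (\1_`]mu, b] x * (x - mu))%:E = 0%E}.
  apply: aeU.
    by apply/measurable_EFinP; apply: measurable_funM => //; exact: measurable_funB.
  move=> x; rewrite lee_fin indicE.
  case: (boolP (x \in _)) => [/set_mem /=|]; rewrite ?mul0r//.
  by rewrite in_itv /= mul1r subr_ge0 => /andP[/ltW].
have {}aeL : {ae F, forall x, [set: R] x -> (\1_`[a, mu] x * (mu - x))%:E = 0%E}.
  apply: aeL.
    by apply/measurable_EFinP; apply: measurable_funM => //; exact: measurable_funB.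
  move=> x; rewrite lee_fin indicE.
  case: (boolP (x \in _)) => [/set_mem /=|]; rewrite ?mul0r//.
  by rewrite in_itv /= mul1r subr_ge0 => /andP[].
apply/probability1P => //.
apply: filterS3 aeI aeU aeL.
move=> x /=; rewrite in_itv /= => /andP[ax xb] /(_ Logic.I) + /(_ Logic.I).
rewrite !indicE !mem_setE !in_itv /= ax xb andbT /=.
by case: (ltgtP x mu) => //= xmu; rewrite mul1r => -[] + []; lra.
Qed.

Lemma exists_concentrated_sum {d : measure_display} {Omega : measurableType d}
    (P : probability Omega R) (n : nat) :
  a < b -> generates_independent_vectors P ->
  exists2 S : {RV P >-> R}, admissible_sums P n F S &
    P (S @^-1` `[n%:R * mu - (b - a), n%:R * mu + (b - a)]%classic) = 1%E.
Proof.
move=> ab rich.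
have [c [c0 Eu El]] := mean_deviations_balance a b mu F F_supp F_mean.
have inA s : `|s - n%:R * mu| <= b - a ->
    s \in `[n%:R * mu - (b - a), n%:R * mu + (b - a)].
  by rewrite in_itv /= ler_norml => /andP[? ?]; apply/andP; split; lra.
(* If [c = 0] the state measure is null and cannot be normalised, but then [F] is the point mass at
   [mu]. The auxiliary space is then [R] under [F], with every summand the identity, and the sum is
   [n mu] on the set [D] consisting of [mu]. *)
move: c0; rewrite le_eqVlt => /predU1P[c0|c0].
  rewrite -c0 in Eu El; have Fmu := degenerate_of_no_deviation Eu El.
  apply: (exists_admissible_sum P F F n (fun=> idfun) _ [set mu]) => //.
    by move=> i; exact: measurable_id.
  move=> _ ->; apply: inA; rewrite sumr_const card_ord -[_ *+ n]/(mu *+ n) -(mulr_natl mu) subrr normr0.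
  by rewrite subr_ge0 ltW.
pose SM := state_measure a b mu F.
have lawB B : measurable B -> SM (draw mu @^-1` B) = (c%:E * F B)%E.
  by move=> mB; exact: state_measure_draw_law.
have SMT : SM setT = c%:E.
  by rewrite -(preimage_setT (draw mu)) lawB// [X in (_ * X)%E](@probability_setT _ _ _ F) mule1.
(* [\d_point] is a dummy: [mnormalize] uses it only for a null measure. *)
pose Q : probability _ R := mnormalize SM (\d_point).
have QE A : Q A = (SM A * (c^-1)%:E)%E.
  by rewrite /Q /= /mnormalize /= SMT /= eqe gt_eqF.
apply: (exists_admissible_sum P Q F n
  (fun i => draw mu \o iter i (rotate mu)) _ (states a b mu)) => //.
- move=> i; apply: measurableT_comp; first exact: measurable_draw.
  move=> _ A mA; rewrite setTI; exact: (iter_rotate_preimage i A mA).1.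
- move=> i B mB; rewrite QE.
  have mD : measurable (draw mu @^-1` B).
    by rewrite -[X in measurable X]setTI; exact: measurable_draw.
  (* By invariance the draw after [i] rotations has the same law as the first one. *)
  have [_ E] := iter_rotate_preimage i _ mD.
  rewrite comp_preimage [X in (X * _)%E]E -/SM lawB//.
  by rewrite muleAC -EFinM divff ?mul1e// gt_eqF.
- exact: measurable_states.
- rewrite QE (_ : SM (states a b mu) = c%:E) -?EFinM ?divff ?gt_eqF//.
  by rewrite -SMT /SM /state_measure /= /mrestr setIid setTI.
- by move=> z zS; apply: inA; exact: sum_draw_dist.
Qed.

End Concentration.

(** * Mean and range of an arbitrary admissible sum *)

Section AdmissibleSums.
Context {d : measure_display} {Omega : measurableType d} {R : realType}.
Variables (P : probability Omega R) (a b mu : R) (F : probability R R).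
Hypothesis F_supp : F `[a, b]%classic = 1%E.
Hypothesis F_mean : ('E_F[idfun] = mu%:E)%E.

Lemma has_law_support (X : {RV P >-> R}) : has_law X F ->
  P (X @^-1` `[a, b]%classic) = 1%E.
Proof. by move=> lawX; rewrite -F_supp; apply: lawX; exact: measurable_itv. Qed.

Lemma has_law_integral (X : {RV P >-> R}) : has_law X F ->
  P.-integrable setT (EFin \o X) /\ (\int[P]_w (X w)%:E = mu%:E)%E.
Proof.
move=> lawX.
have iX : P.-integrable setT (EFin \o X).
  apply: (integrable_bounded_on P (X @^-1` `[a, b]%classic) _
    (has_law_support X lawX) X (`|a| + `|b|)) => //.
    by rewrite -[X in measurable X]setTI; exact: measurable_funPT.
  move=> w /=; rewrite in_itv /= => /andP[ax xb].
  have := ler_norm a; have := ler_norm b.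
  have := ler_norm (- a); have := ler_norm (- b).
  by rewrite !normrN ler_norml /=; move=> *; apply/andP; split; lra.
split => //; rewrite -F_mean unlock.
rewrite -(@integral_distribution _ _ _ _ _ P X EFin)//.
by apply: eq_measure_integral => B mB _; exact: lawX.
Qed.

Lemma admissible_sum_expectation (n : nat) (S : {RV P >-> R}) :
  admissible_sums P n F S -> ('E_P[S] = (n%:R * mu)%:E)%E.
Proof.
move=> [X lawX SE]; rewrite unlock.
under eq_integral do rewrite SE -sumEFin.
rewrite integral_sum//; last by move=> i; exact: (has_law_integral _ (lawX i)).1.
under eq_bigr => i _ do rewrite (has_law_integral _ (lawX i)).2.
by rewrite sumEFin sumr_const card_ord -(mulr_natl mu).
Qed.

(** This gives every admissible sum an almost surely bounded range, from which the lower bound gets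
    the integrability of [g \o S]. *)
Lemma admissible_sum_support (n : nat) (S : {RV P >-> R}) :
  admissible_sums P n F S ->
  P (S @^-1` `[n%:R * a, n%:R * b]%classic) = 1%E.
Proof.
move=> [X lawX SE].
have mpre (Y : {RV P >-> R}) (u v : R) : measurable (Y @^-1` `[u, v]%classic).
  by rewrite -[X in measurable X]setTI; exact: measurable_funPT.
have : \forall w \ae P, forall i, (X i @^-1` `[a, b]%classic) w.
  apply: filter_forall => i; apply/probability1P; first exact: mpre.
  exact: has_law_support.
move=> aeX; apply/probability1P; first exact: mpre.
apply: filterS aeX => w Xw; rewrite /preimage /= SE in_itv /=.
have nM (c : R) : n%:R * c = \sum_(i < n) c.
  by rewrite sumr_const card_ord -(mulr_natl c).
rewrite !nM; apply/andP; split; apply: ler_sum => i _;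
  by have := Xw i; rewrite /preimage /= in_itv /= => /andP[].
Qed.

End AdmissibleSums.

(** * The two bounds on the infimum *)

Theorem theorem3p2 (R : realType) (d : measure_display)
    (Omega : measurableType d) (P : probability Omega R)
    (P_atomless : atomless P)
    (P_rich : generates_independent_vectors P)
    (a b : R) (ab : a < b) (F : probability R R)
    (F_supp : F `[a, b]%classic = 1%E)
    (mu : R) (F_mean : ('E_F[idfun] = mu%:E)%E)
    (n : nat) (g : R -> R)
    (g_convex : convex_function (E := R^o) setT g) :
  ((g (n%:R * mu))%:E
     <= ereal_inf [set 'E_P[g \o S] | S in admissible_sums P n F])%E /\
  (ereal_inf [set 'E_P[g \o S] | S in admissible_sums P n F]
     <= (1 / 2 * g (n%:R * mu + (b - a))
         + 1 / 2 * g (n%:R * mu - (b - a)))%:E)%E.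
Proof.
have mpre (Y : {RV P >-> R}) (u v : R) : measurable (Y @^-1` `[u, v]%classic).
  by rewrite -[X in measurable X]setTI; exact: measurable_funPT.
have d0 : 0 < b - a by rewrite subr_gt0.
split.
- apply: le_ereal_inf_tmp => _ [S Sadm <-].
  have PS := admissible_sum_support P a b F F_supp n S Sadm.
  have ES := admissible_sum_expectation P a b mu F F_supp F_mean n S Sadm.
  (* Adding 1 keeps the interval nondegenerate when [n = 0]; its endpoints do not enter the lower
     bound. *)
  have lohi : n%:R * a < n%:R * b + 1.
    by rewrite ltr_pwDr// ler_wpM2l// ltW.
  have Sb w : (S @^-1` `[n%:R * a, n%:R * b]%classic) w ->
      n%:R * a <= S w <= n%:R * b + 1.
    rewrite /preimage /= in_itv /= => /andP[-> /le_trans]; apply.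
    by rewrite lerDl.
  by have /andP[] := convex_expectation_bounds P _ (mpre S _ _) PS g S _ _ _
    g_convex (measurable_funPT S) ES lohi Sb.
- have [S Sadm PS] := exists_concentrated_sum a b mu F F_supp F_mean P n ab P_rich.
  have ES := admissible_sum_expectation P a b mu F F_supp F_mean n S Sadm.
  apply: (@le_trans _ _ ('E_P[g \o S])%E).
    by apply: ereal_inf_lbound; exists S.
  have lohi : n%:R * mu - (b - a) < n%:R * mu + (b - a) by lra.
  have Sb w : (S @^-1` `[n%:R * mu - (b - a), n%:R * mu + (b - a)]%classic) w ->
      n%:R * mu - (b - a) <= S w <= n%:R * mu + (b - a).
    by rewrite /preimage /= in_itv.
  have /andP[] := convex_expectation_bounds P _ (mpre S _ _) PS g S _ _ _
    g_convex (measurable_funPT S) ES lohi Sb.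
  (* The mean [n mu] is the midpoint of the interval, where the chord takes the average of its end
     values. *)
  move=> _ /le_trans; apply; rewrite lee_fin le_eqVlt; apply/orP; left.
  apply/eqP; field; lra.
Qed.
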